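(* Let $r \geq 3$ be an integer and let $(E,G)$ be a fano-free rank-$r$ binary representation with $|E| > \frac{5}{8}2^r$. Then there is a hyperplane $H$ of $G$ such that $(E \cap H, G|H)$ is triangle-free. Furthermore, $|E \cap H| > \frac{1}{4}2^{r-1}$.
   Context: A rank-$r$ binary representation is an ordered pair $(E,G)$ where $G \cong \mathrm{PG}(r-1,2)$ and $E$ is a subset of the points of $G$; it represents the simple binary matroid $G|E$. A matroid is $N$-free if it has no restriction isomorphic to $N$, and $(E,G)$ is $N$-free when $G|E$ is. A fano is a matroid isomorphic to $F_7 \cong \mathrm{PG}(2,2)$; a triangle is a matroid isomorphic to $\mathrm{PG}(1,2) \cong U_{2,3}$, and triangle-free means $\mathrm{PG}(1,2)$-free. For a hyperplane $H$ of $G$, $(E\cap H, G|H)$ is the binary representation with ambient geometry $G|H$ and ground set $E\cap H$. *)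

(* Defs.v *)
From HB Require Import structures.
From mathcomp Require Import all_boot all_order all_algebra.
Set Implicit Arguments.
Unset Strict Implicit.
Unset Printing Implicit Defensive.
Import Order.TTheory GRing.Theory Num.Theory.
Local Open Scope ring_scope.

Record matroid (T : finType) := Matroid {
  ground : {set T};
  indep : pred {set T};
  indep_ground : forall I : {set T}, indep I -> I \subset ground;
  indep0 : indep set0;
  indep_sub : forall I J : {set T}, I \subset J -> indep J -> indep I;
  indep_aug : forall I J : {set T}, indep I -> indep J -> (#|I| < #|J|)%N ->
    exists2 e, e \in J :\: I & indep (e |: I)
}.

Section Restriction.
Variables (T : finType) (M : matroid T) (X : {set T}).

Definition restr_indep : pred {set T} := fun I => indep M I && (I \subset X).

Lemma restr_indep_ground I : restr_indep I -> I \subset ground M :&: X.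
Proof. by case/andP=> /indep_ground IM IX; rewrite subsetI IM. Qed.

Lemma restr_indep0 : restr_indep set0.
Proof. by rewrite /restr_indep indep0 sub0set. Qed.

Lemma restr_indep_sub (I J : {set T}) :
  I \subset J -> restr_indep J -> restr_indep I.
Proof.
move=> IJ /andP[Ji JX]; rewrite /restr_indep (indep_sub IJ Ji) /=.
exact: subset_trans JX.
Qed.

Lemma restr_indep_aug (I J : {set T}) :
  restr_indep I -> restr_indep J -> (#|I| < #|J|)%N ->
  exists2 e, e \in J :\: I & restr_indep (e |: I).
Proof.
move=> /andP[Ii IX] /andP[Ji JX] lIJ; have [e eJI ei] := indep_aug Ii Ji lIJ.
exists e => //; rewrite /restr_indep ei subUset sub1set IX andbT /=.
by case/setDP: eJI => /(subsetP JX).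
Qed.

Definition restriction : matroid T :=
  Matroid restr_indep_ground restr_indep0 restr_indep_sub restr_indep_aug.

End Restriction.

(* The bijection is defined on the ground set only, so that no assumption on
   the carrier types is needed. *)
Definition isomorphic (T U : finType) (M : matroid T) (N : matroid U) : Prop :=
  exists f : {x : T | x \in ground M} -> U,
    [/\ injective f,
        f @: [set: {x : T | x \in ground M}] = ground N
      & forall I : {set {x : T | x \in ground M}},
          indep N (f @: I) = indep M (val @: I)].

Definition matroid_free (T U : finType) (N : matroid U) (M : matroid T) : Prop :=
  ~ exists2 X : {set T}, X \subset ground M & isomorphic (restriction M X) N.

Definition rank (T : finType) (M : matroid T) (X : {set T}) : nat :=
  \max_(I : {set T} | indep M I && (I \subset X)) #|I|.

Definition flat (T : finType) (M : matroid T) (F : {set T}) : bool :=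
  (F \subset ground M) &&
  [forall e in ground M :\: F, (rank M F < rank M (e |: F))%N].

Definition hyperplane (T : finType) (M : matroid T) (H : {set T}) : bool :=
  flat M H && ((rank M H).+1 == rank M (ground M)).

Section ProjectiveGeometry.
Variable n : nat.
Local Notation V := 'rV['F_2]_n.

Definition PG_indep : pred {set V} := fun I => free (enum I).

Lemma PG_indep_ground (I : {set V}) : PG_indep I -> I \subset [set v | v != 0].
Proof.
move=> Ii; apply/subsetP=> v vI; rewrite inE.
by rewrite (free_not0 Ii) // mem_enum.
Qed.

Lemma PG_indep0 : PG_indep set0.
Proof. by rewrite /PG_indep enum_set0 nil_free. Qed.

Lemma PG_indep_sub (I J : {set V}) : I \subset J -> PG_indep J -> PG_indep I.
Proof.
move=> IJ Ji; rewrite /PG_indep.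
have -> : free (enum I) = free [seq x <- enum J | x \in I].
  apply/perm_free/uniq_perm => [||x]; first exact: enum_uniq.
    exact/filter_uniq/enum_uniq.
  rewrite mem_enum mem_filter mem_enum andb_idr // => xI; exact: (subsetP IJ).
exact: filter_free.
Qed.

Lemma PG_indep_aug (I J : {set V}) :
  PG_indep I -> PG_indep J -> (#|I| < #|J|)%N ->
  exists2 e, e \in J :\: I & PG_indep (e |: I).
Proof.
move=> Ii Ji lIJ.
have [e eJ eI] : exists2 e, e \in J & e \notin <<enum I>>%VS.
  apply/exists_inP; apply: contraLR lIJ; rewrite -leqNgt => /exists_inPn sJ.
  rewrite !cardE -(eqP (Ii : \dim _ == _)) -(eqP (Ji : \dim _ == _)).
  apply/dimvS/span_subvP => v; rewrite mem_enum => /sJ; by rewrite negbK.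
have neI : e \notin I.
  by apply: contra eI => eI; rewrite memv_span // mem_enum.
exists e; first by rewrite inE neI.
rewrite /PG_indep (@perm_free _ _ _ (e :: enum I)); first by rewrite free_cons eI.
apply: uniq_perm => [||x]; first exact: enum_uniq.
  by rewrite /= mem_enum neI; exact: enum_uniq.
by rewrite mem_enum !inE mem_enum.
Qed.

(* PG n is the geometry PG(n - 1, 2), of rank n. Over the two-element field
   each point, i.e. one-dimensional subspace, has exactly one nonzero vector,
   so the points are the nonzero vectors. *)
Definition PG : matroid V :=
  Matroid PG_indep_ground PG_indep0 PG_indep_sub PG_indep_aug.

End ProjectiveGeometry.

Definition fano : matroid 'rV['F_2]_3 := PG 3.
Definition triangle : matroid 'rV['F_2]_2 := PG 2.

Definition binary_representation (r : nat) (T : finType)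
    (E : {set T}) (G : matroid T) : Prop :=
  isomorphic G (PG r) /\ E \subset ground G.

Definition represented_matroid (T : finType) (E : {set T}) (G : matroid T) :
  matroid T := restriction G E.

Definition fano_free (T : finType) (E : {set T}) (G : matroid T) : Prop :=
  matroid_free fano (represented_matroid E G).

Definition triangle_free (T : finType) (E : {set T}) (G : matroid T) : Prop :=
  matroid_free triangle (represented_matroid E G).

(* Main.v *)
(** Identify the points of [G] with the nonzero vectors of [V = F_2^r], write
    [N = 2^r], and suppose that [E] contains a triangle [a, b, a + b].
    Averaging over the cosets of its span gives some [c] in the triangle for
    which [D = E :&: (E + c)] has more than [N / 3] elements, and [D] is
    sum-free because [E] is fano-free.  Comparing the second and third moments
    of the Fourier transform of [D] yields a hyperplane [H] of [V] with more
    than [N / 4] elements of [D] outside it; a point of [D] inside [H] would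
    translate these to a disjoint set outside [H], so [D] avoids [H].  Hence [c]
    lies in [H] and [E :&: H] contains at most half of [H].  A triangle in
    [E :&: H] would force [E] to miss a point in each coset of its span outside
    [H], so that [#|E| <= N / 4 + 3 N / 8 = 5 N / 8]. *)
Require Import Defs.
From mathcomp Require Import all_boot all_order all_algebra.
From mathcomp Require Import zify ring lra.
Local Open Scope ring_scope.
Set Implicit Arguments.
Unset Strict Implicit.
Unset Printing Implicit Defensive.
Import Order.TTheory GRing.Theory Num.Theory.

(** * Characters and Fourier moments over the two-element field *)

Lemma F2_cases (c : 'F_2) : c = 0 \/ c = 1.
Proof. by case: c => [[|[|//]] i]; [left|right]; apply: val_inj. Qed.

Section BinarySpace.
Variable n : nat.
Local Notation V := 'rV['F_2]_n.
Implicit Types (u v x y z a b p q : V) (D E S : {set V}).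

Lemma addvv x : x + x = 0.
Proof.
apply/rowP => i; rewrite !mxE.
by case: (F2_cases (x 0 i)) => ->; apply: val_inj.
Qed.

Lemma addvK z : involutive (+%R^~ z).
Proof. by move=> x; rewrite -addrA addvv addr0. Qed.

Lemma addv_eq0 x y : (x + y == 0) = (x == y).
Proof. by rewrite -(inj_eq (can_inj (addvK y))) addvK add0r. Qed.

Lemma card_space : #|{: V}| = (2 ^ n)%N.
Proof. by rewrite card_mx card_Fp // mul1n. Qed.

Definition dot u x : 'F_2 := (x *m u^T) 0 0.

Lemma dotDr u x y : dot u (x + y) = dot u x + dot u y.
Proof. by rewrite /dot mulmxDl mxE. Qed.

Lemma dotC u x : dot u x = dot x u.
Proof. by rewrite /dot -[in LHS](trmxK x) -trmx_mul mxE. Qed.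

Lemma dot_nondeg x : x != 0 -> exists u, dot u x = 1.
Proof.
case/rV0Pn => i xi; exists (delta_mx 0 i); rewrite /dot trmx_delta -colE mxE.
by case: (F2_cases (x 0 i)) xi => // ->; rewrite eqxx.
Qed.

(** The character [(-1)^(dot u x)], with integer values so that moments can be compared by integer
    arithmetic. *)
Definition chi u x : int := if dot u x == 0 then 1 else -1.

Lemma chiC u x : chi u x = chi x u.
Proof. by rewrite /chi dotC. Qed.

Lemma chiD u x y : chi u (x + y) = chi u x * chi u y.
Proof.
rewrite /chi dotDr.
by case: (F2_cases (dot u x)) => ->; case: (F2_cases (dot u y)) => ->.
Qed.

Lemma sum_chi x : \sum_u chi u x = if x == 0 then (2 ^ n)%:R else 0.
Proof.
case: eqVneq => [->|/dot_nondeg [v vx]].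
  rewrite (eq_bigr (fun=> 1)) => [|u _]; last by rewrite /chi /dot mul0mx mxE.
  by rewrite sumr_const cardE -cardT card_space.
(* Translating the index by [v], where [dot v x = 1], flips the sign of every term. *)
have : \sum_u chi u x = - \sum_u chi u x.
  rewrite {1}(reindex_inj (can_inj (addvK v))) -sumrN; apply: eq_bigr => u _.
  by rewrite chiC chiD -!(chiC _ x) /(chi v) vx mulrN1.
lia.
Qed.

Definition fourier D u : int := \sum_(x in D) chi u x.

Lemma fourier0 D : fourier D 0 = #|D|%:R.
Proof.
rewrite /fourier (eq_bigr (fun=> 1)) ?sumr_const // => x _.
by rewrite chiC /chi /dot mul0mx mxE.
Qed.

Lemma fourierE D u :
  fourier D u = #|D|%:R - 2 * #|[set x in D | dot u x != 0]|%:R.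
Proof.
rewrite /fourier -!sum1_card !natr_sum.
under [X in _ - 2 * X]eq_bigl => x do rewrite inE.
rewrite big_mkcondr mulr_sumr -sumrB; apply: eq_bigr => x _.
by rewrite /chi; case: eqP.
Qed.

(** Parseval: after expanding the square, orthogonality of characters keeps only the pairs with
    [x = y]. *)
Lemma sum_fourier_sq D : \sum_u fourier D u ^+ 2 = (2 ^ n)%:R * #|D|%:R.
Proof.
under eq_bigr => u _ do rewrite expr2 /fourier big_distrlr /=.
rewrite exchange_big /= -sum1_card natr_sum mulr_sumr; apply: eq_bigr => x xD.
rewrite exchange_big /= (bigD1 x) //= [X in _ + X]big1 ?addr0 => [|y /andP[_ yx]].
  by under eq_bigr => u _ do rewrite -chiD; rewrite sum_chi addvv eqxx mulr1.
under eq_bigr => u _ do rewrite -chiD.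
by rewrite sum_chi addv_eq0 eq_sym (negbTE yx).
Qed.

Definition sum_free D := forall x y, x \in D -> y \in D -> x + y \notin D.

(** The third moment is [2 ^ n] times the number of triples in [D] with [x + y + z = 0]; such a
    triple has [z = x + y]. *)
Lemma sum_fourier_cube D : sum_free D -> \sum_u fourier D u ^+ 3 = 0.
Proof.
move=> Dsf.
under eq_bigr => u _ do rewrite exprSr expr2 /fourier !big_distrlr /=.
rewrite exchange_big big1 //= => x xD.
rewrite exchange_big big1 //= => y yD.
under eq_bigr => u _ do rewrite mulr_suml.
rewrite exchange_big big1 //= => z zD.
under eq_bigr => u _ do rewrite -!chiD.
rewrite sum_chi addv_eq0; case: eqP yD => // <-.
by rewrite (negbTE (Dsf _ _ xD zD)).
Qed.

(** The Fourier transform of the whole space vanishes at [u != 0], so the two fibres of [dot u]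
    balance. *)
Lemma card_dot u (c : 'F_2) : u != 0 -> (#|[set x | dot u x == c]| * 2 = 2 ^ n)%N.
Proof.
move=> u0.
have E0 := fourierE setT u.
have S0 : fourier setT u = 0.
  rewrite /fourier; under eq_bigl => x do rewrite inE.
  by under eq_bigr => x _ do rewrite chiC; rewrite sum_chi (negbTE u0).
have e1 : [set x in setT | dot u x != 0] = [set x | dot u x == 1].
  by apply/setP => x; rewrite !inE; case: (F2_cases (dot u x)) => ->.
have e0 : [set x | dot u x == 0] = ~: [set x | dot u x == 1].
  by apply/setP => x; rewrite !inE; case: (F2_cases (dot u x)) => ->.
have := cardsC [set x | dot u x == 1]; rewrite -e0 card_space.
move: E0; rewrite S0 cardsT card_space e1.
rewrite !natz; case: (F2_cases c) => ->;
  move: #|[set x | dot u x == 1]| #|[set x | dot u x == 0]| (2 ^ n)%N; lia.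
Qed.

(** * Counting by translations, and the structure of large sum-free sets *)

Lemma sum_shift S E z : (forall x, (x + z \in S) = (x \in S)) ->
  (\sum_(x in S) ((x + z)%R \in E) = #|E :&: S|)%N.
Proof.
move=> Sz; rewrite (reindex_inj (can_inj (addvK z))) /= -sum1_card.
under eq_bigl => x do rewrite Sz.
under [RHS]eq_bigl => x do rewrite inE.
rewrite [RHS]big_mkcondl; apply: eq_bigr => x _.
by rewrite addvK; case: (x \in E).
Qed.

(** The set [E :&: S] and its translate by [z] are disjoint subsets of [S] of equal size. *)
Lemma card_shift_disjoint S E z : (forall x, (x + z \in S) = (x \in S)) ->
    (forall x, x \in S -> ~~ ((x \in E) && (x + z \in E))) ->
  (#|E :&: S| * 2 <= #|S|)%N.
Proof.
move=> Sz disj; have S0 x : (x + 0 \in S) = (x \in S) by rewrite addr0.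
rewrite muln2 -addnn -{1}(sum_shift E S0) -(sum_shift E Sz) -big_split /=.
rewrite -sum1_card; apply: leq_sum => x /disj; rewrite addr0.
by do 2 case: (_ \in _).
Qed.

Lemma sum_free_affine D : sum_free D -> (2 ^ n < 3 * #|D|)%N ->
  exists2 u, u != 0 & forall x, x \in D -> dot u x = 1.
Proof.
move=> Dsf Dbig.
pose D1 u := [set x in D | dot u x != 0].
have [u ubig] : exists u, (2 ^ n < 4 * #|D1 u|)%N.
  apply/existsP; apply: contraLR Dbig; rewrite -leqNgt => /existsPn small.
  pose N : int := (2 ^ n)%:R; pose d : int := #|D|%:R.
  (* If every [D1 u] has at most [N / 4] elements, then [fourier D u >= d - N / 2], so each summand
     is nonnegative. The two moments, less their terms at [u = 0], evaluate the sum as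
     [N * d * (N - 3 * d)]. *)
  have : 0 <= \sum_(u | u != 0) fourier D u ^+ 2 * (2 * fourier D u + (N - 2 * d)).
    apply: sumr_ge0 => u _; apply: mulr_ge0; first exact: sqr_ge0.
    have := small u; rewrite fourierE -/(D1 u) /N /d !natz; lia.
  under eq_bigr => u _ do rewrite mulrDr mulrCA -exprSr mulrC [in X in _ + X]mulrC.
  rewrite big_split /= -mulr_sumr -mulr_suml.
  have := sum_fourier_cube Dsf; have := sum_fourier_sq D.
  rewrite !(bigD1 0 (P := xpredT)) //= fourier0 -/N -/d.
  set A := \sum_(_ | _) _; set B := \sum_(_ | _) _ => hA hB hS.
  have d0 : 0 <= d by rewrite ler0n.
  have N0 : 0 < N by rewrite ltr0n expn_gt0.
  suff : 3 * d <= N by rewrite /N /d -natrM ler_nat.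
  have : 0 <= N * d * (N - 3 * d).
    have -> : N * d * (N - 3 * d) = B * 2 + (N - 2 * d) * A; last by [].
    have -> : A = N * d - d ^+ 2 by rewrite -hA [d ^+ 2 + A]addrC addrK.
    have -> : B = - d ^+ 3 by apply/eqP; rewrite -addr_eq0 addrC hB.
    ring.
  move: d0; rewrite le_eqVlt => /predU1P[<- _|d0]; first by rewrite mulr0 ltW.
  by rewrite pmulr_rge0 ?mulr_gt0 // subr_ge0.
have u0 : u != 0.
  apply: contraTneq ubig => ->.
  rewrite (_ : D1 0 = set0) ?cards0 ?muln0 //.
  by apply/setP => x; rewrite !inE dotC /dot mul0mx mxE eqxx andbF.
exists u => // z zD; case: (F2_cases (dot u z)) => // z0.
(* A point [z] of [D] with [dot u z = 0] preserves the affine half [dot u x = 1]. Sum-freeness makes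
   [D1 u] disjoint from its translate by [z], so [D1 u] has at most [N / 4] elements, against the
   choice of [u]. *)
have uz x : (x + z \in [set x | dot u x == 1]) = (x \in [set x | dot u x == 1]).
  by rewrite !inE dotDr z0 addr0.
have := card_shift_disjoint (E := D) uz.
have -> : D :&: [set x | dot u x == 1] = D1 u.
  by apply/setP => x; rewrite !inE; case: (F2_cases (dot u x)) => ->.
have := card_dot 1 u0; suff dis : forall x, ~~ ((x \in D) && (x + z \in D)).
  move=> h /(_ (fun x _ => dis x)); move: h ubig.
  by move: #|D1 u| #|[set x | dot u x == 1]| (2 ^ n)%N; lia.
by move=> x; apply/andP => -[xD]; rewrite (negbTE (Dsf _ _ xD zD)).
Qed.

(** * Dense fano-free sets of vectors *)

Lemma sum_translate E z : (\sum_x ((x + z)%R \in E) = #|E|)%N.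
Proof.
rewrite -{2}(setIT E) -(@sum_shift setT E z) => [|x]; last by rewrite !inE.
by apply: eq_bigl => x; rewrite inE.
Qed.

Lemma dense_popular_difference E a b :
    (5 * 2 ^ n < 8 * #|E|)%N -> a \in E -> b \in E -> a + b \in E ->
  exists2 c, c \in E & (2 ^ n < 3 * #|[set x in E | (x + c)%R \in E]|)%N.
Proof.
move=> Ebig aE bE abE; pose D c : {set V} := [set x in E | x + c \in E].
have : (8 * #|E| <= 3 * 2 ^ n + 2 * (#|D a| + #|D b| + #|D (a + b)%R|))%N.
  have -> : (8 * #|E| = \sum_x 2 * ((x + 0 \in E)%R + (x + a \in E)%R
      + (x + b \in E)%R + (x + (a + b) \in E)%R))%N.
    by rewrite -big_distrr !big_split !sum_translate /=; lia.
  (* The six indicators run over the six pairs of points in the coset [x + {0, a, b, a + b}]; each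
     is 1 exactly when both points of its pair lie in [E]. *)
  have -> : (3 * 2 ^ n + 2 * (#|D a| + #|D b| + #|D (a + b)%R|)
      = \sum_x (3 + ((x + 0 \in D a)%R + (x + b \in D a)%R + (x + 0 \in D b)%R
        + (x + a \in D b)%R + (x + 0 \in D (a + b)%R)%R + (x + a \in D (a + b)%R)%R)))%N.
    rewrite !big_split !sum_translate /= sum_nat_const cardT -cardE card_space; lia.
  (* On a coset with [k] points in [E], this is ['C(k, 2) >= 2 * k - 3]. *)
  apply: leq_sum => x _; rewrite !inE addr0 -!addrA [b + a]addrC.
  rewrite [a + (a + b)]addrA addvv add0r !addrA.
  by do 4 case: (_ \in E).
(* The three cardinals sum to more than [2 ^ n], so one of them exceeds a third of it. *)
move=> le; case: (ltnP (2 ^ n) (3 * #|D a|)) => [|la]; first by exists a.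
case: (ltnP (2 ^ n) (3 * #|D b|)) => [|lb]; first by exists b.
case: (ltnP (2 ^ n) (3 * #|D (a + b)%R|)) => [|lab]; first by exists (a + b).
lia.
Qed.

Lemma dense_fano_free E : 0 \notin E ->
    (forall a x y, a \in E -> x \in E -> y \in E -> a + x \in E ->
       a + y \in E -> x + y \in E -> a + x + y \notin E) ->
    (5 * 2 ^ n < 8 * #|E|)%N ->
  exists2 u, u != 0 & forall p q, p \in E -> q \in E -> p + q \in E ->
    dot u p = 0 -> dot u q = 0 -> False.
Proof.
move=> E0 fano Ebig.
case: (boolP [exists a in E, exists b in E, a + b \in E]); last first.
  (* Without a triangle in [E] any nonzero [u] serves; a point of [E] is one. *)
  move=> notri; have [e eE] : exists e, e \in E.
    by apply/card_gt0P; case: #|E| Ebig; lia.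
  exists e => [|p q pE qE pqE _ _]; first by apply: contraNneq E0 => <-.
  case/negP: notri; apply/exists_inP; exists p => //.
  by apply/exists_inP; exists q.
case/exists_inP => a aE /exists_inP[b bE abE].
have [c cE cbig] := dense_popular_difference Ebig aE bE abE.
set D := [set _ in _ | _] in cbig.
(* If [x], [y] and [x + y] were all in [D], then [c], [x], [y] and all their sums would be seven
   points of [E] forming a fano. *)
have Dsf : sum_free D.
  move=> x y; rewrite !inE => /andP[xE xcE] /andP[yE ycE].
  apply/andP => -[xyE]; apply/negP; rewrite addrC addrA.
  by apply: fano; rewrite // addrC.
have [u u0 uD] := sum_free_affine Dsf cbig.
(* [D] is stable under translation by [c], and [dot u] is constantly 1 on it. *)
have uc : dot u c = 0.
  have [x xD] : exists x, x \in D by apply/card_gt0P; case: #|D| cbig; lia.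
  have : x + c \in D by move: xD; rewrite !inE addvK andbC.
  by move/uD; rewrite dotDr (uD _ xD) -[RHS]addr0 => /addrI.
exists u => // p q pE qE pqE up uq.
pose K (i : 'F_2) : {set V} := [set x | dot u x == i].
have KD i z : dot u z = 0 -> forall x, (x + z \in K i) = (x \in K i).
  by move=> uz x; rewrite !inE dotDr uz addr0.
have EK0 : (#|E :&: K 0%R| * 2 <= #|K 0%R|)%N.
  apply: card_shift_disjoint (KD 0 c uc) _ => x; rewrite inE => /eqP ux.
  apply/negP => xD; have := uD x; rewrite inE => /(_ xD); rewrite ux.
  by move/eqP; rewrite eq_sym oner_eq0.
(* Each coset [x + {0, p, q, p + q}] with [x] in [K 1] stays in [K 1] and misses a point of [E]:
   otherwise, together with [p], [q], [p + q], it would form a fano. *)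
have EK1 : (#|E :&: K 1%R| * 4 <= #|K 1%R| * 3)%N.
  have u00 : dot u 0 = 0 by rewrite /dot mul0mx mxE.
  have upq : dot u (p + q) = 0 by rewrite dotDr up uq addr0.
  have -> : (#|E :&: K 1%R| * 4 = \sum_(x in K 1%R) ((x + 0 \in E)%R + (x + p \in E)%R
      + (x + q \in E)%R + (x + (p + q) \in E)%R))%N.
    rewrite !big_split !sum_shift /=; [lia|exact: KD..].
  rewrite -sum_nat_const; apply: leq_sum => x _; rewrite addr0.
  have := fano p q x pE qE; rewrite pqE ![_ + x]addrC.
  by do 4 case: (_ \in E) => //; move=> /(_ isT isT isT isT).
have EK : #|E| = (#|E :&: K 0%R| + #|E :&: K 1%R|)%N.
  rewrite -(cardsID (K 0) E); congr (_ + #|pred_of_set _|)%N; apply/setP => x.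
  by rewrite !inE andbC; case: (F2_cases (dot u x)) => ->.
have := card_dot 0 u0; have := card_dot 1 u0; rewrite -/(K 0) -/(K 1).
move: EK EK0 EK1 Ebig => ->.
move: #|K 0| #|K 1| #|_ :&: K 0| #|_ :&: K 1| (2 ^ n)%N; lia.
Qed.

End BinarySpace.

(** * Vector coordinates for binary matroids *)

Lemma isomorphic_fun (T U : finType) (M : matroid T) (N : matroid U) (u0 : U) :
  isomorphic M N -> exists h : T -> U,
    [/\ {in ground M &, injective h}, h @: ground M = ground N
      & forall I : {set T}, I \subset ground M -> indep M I = indep N (h @: I)].
Proof.
(* [u0] is the default value outside the ground set. *)
case=> f [finj fim findep]; pose h t := oapp f u0 (insub t).
have hE x : h (val x) = f x by rewrite /h valK.
have imE (I : {set {x : T | x \in ground M}}) : h @: (val @: I) = f @: I.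
  by rewrite -imset_comp; apply: eq_imset => x; rewrite /= hE.
have valI (I : {set T}) : I \subset ground M ->
    I = val @: [set x : {x : T | x \in ground M} | val x \in I].
  move=> /subsetP IM; apply/setP => t; apply/idP/imsetP => [tI|[x + ->]].
    by exists (Sub t (IM _ tI)); rewrite ?inE SubK.
  by rewrite inE.
exists h; split=> [s t sM tM||I IM].
- by have := hE (exist _ s sM); have := hE (exist _ t tM) => /= -> -> /finj [].
- have := valI _ (subxx (ground M)).
  have -> : [set x | val x \in ground M] = [set: {x | x \in ground M}].
    by apply/setP => x; rewrite !inE (valP x).
  by move=> {1}->; rewrite imE.
- by rewrite {1}(valI _ IM) -findep [in RHS](valI _ IM) imE.
Qed.

Lemma fun_isomorphic (T U : finType) (M : matroid T) (N : matroid U) (h : T -> U) :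
    {in ground M &, injective h} -> h @: ground M = ground N ->
    (forall I : {set T}, I \subset ground M -> indep M I = indep N (h @: I)) ->
  isomorphic M N.
Proof.
move=> hinj him hindep; exists (fun x => h (val x)).
have imE (I : {set {x : T | x \in ground M}}) :
    (fun x => h (val x)) @: I = h @: (val @: I) by rewrite -imset_comp.
split=> [x y /hinj xy||I].
- by apply/val_inj/xy; exact: valP.
- rewrite imE -him; suff -> : val @: [set: {x | x \in ground M}] = ground M by [].
  apply/setP => t; apply/imsetP/idP => [[x _ ->]|tM]; first exact: valP.
  by exists (Sub t tM); rewrite ?inE ?SubK.
- rewrite imE hindep //; apply/subsetP => t /imsetP[x _ ->]; exact: valP.
Qed.

(** The image of the ground set is left free, so that the same [h] gives coordinates on every
    restriction. *)
Definition binary_coordinates (n : nat) (T : finType) (M : matroid T)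
    (h : T -> 'rV['F_2]_n) : Prop :=
  {in ground M &, injective h} /\
  forall I : {set T}, I \subset ground M -> indep M I = PG_indep (h @: I).

Lemma restriction_coordinates n (T : finType) (M : matroid T)
    (h : T -> 'rV['F_2]_n) (X : {set T}) :
  binary_coordinates M h -> binary_coordinates (restriction M X) h.
Proof.
case=> hinj hindep; split=> [s t /= /setIP[sM _] /setIP[tM _]|I /=].
  exact: hinj.
by rewrite subsetI /restr_indep => /andP[IM ->]; rewrite andbT hindep.
Qed.

Lemma PG_indep_set n (s : seq 'rV['F_2]_n) :
  uniq s -> PG_indep [set x in s] = free s.
Proof.
move=> us; apply/perm_free/uniq_perm => // [|x]; first exact: enum_uniq.
by rewrite mem_enum inE.
Qed.

Lemma PG_indep_linear m n (f : {linear 'rV['F_2]_m -> 'rV['F_2]_n})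
    (I : {set 'rV['F_2]_m}) :
  injective f -> PG_indep (f @: I) = PG_indep I.
Proof.
move=> finj; have -> : f @: I = [set x in map f (enum I)].
  apply/setP => y; rewrite inE; apply/imsetP/mapP => -[x xI ->];
    by exists x; rewrite // mem_enum in xI *.
rewrite PG_indep_set ?map_inj_uniq ?enum_uniq //.
have fE : map f (enum I) = map (linfun f) (enum I).
  by apply: eq_map => x; rewrite lfunE.
rewrite /PG_indep /free fE -limg_span limg_dim_eq ?size_map //.
apply/eqP; rewrite -subv0; apply/subvP => x; rewrite memv_cap memv_ker lfunE /=.
by rewrite -[0](linear0 f) (inj_eq finj) memv0 => /andP[].
Qed.

Lemma coordinates_free n (T : finType) (M : matroid T) (h : T -> 'rV['F_2]_n)
    (s : seq T) :
  binary_coordinates M h -> uniq s -> {subset s <= ground M} ->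
  indep M [set t in s] = free (map h s).
Proof.
case=> hinj hindep us sM.
rewrite hindep; last by apply/subsetP => t; rewrite inE => /sM.
rewrite -PG_indep_set.
  congr PG_indep; apply/setP => y; rewrite inE.
  by apply/imsetP/mapP => -[x xI ->]; exists x; rewrite // inE in xI *.
by rewrite map_inj_in_uniq // => x y /sM xM /sM yM; apply: hinj.
Qed.

Section Coordinates.
Variables (n : nat) (T : finType) (M : matroid T) (h : T -> 'rV['F_2]_n).
Hypothesis hM : binary_coordinates M h.

Lemma rank_coordinates (X : {set T}) : X \subset ground M ->
  rank M X = \dim <<enum (h @: X)%SET>>%VS.
Proof.
case: hM => hinj hindep XM.
have dimI (I : {set T}) : I \subset ground M -> indep M I ->
    \dim <<enum (h @: I)%SET>>%VS = #|I|.
  move=> IM; rewrite hindep // => /eqP ->; rewrite -cardE card_in_imset //.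
  by move=> x y /(subsetP IM) xM /(subsetP IM) yM; apply: hinj.
apply/eqP; rewrite eqn_leq; apply/andP; split.
  apply/bigmax_leqP => I /andP[Ii IX]; rewrite -dimI ?(subset_trans IX) //.
  by apply/dimvS/sub_span => x; rewrite !mem_enum; apply/subsetP/imsetS.
(* A maximal independent [I] inside [X] spans the image of [X]: a point outside the span could be
   added to [I]. *)
have [I /maxsetP[/andP[Ii IX] Imax] _] :
    {I : {set T} | maxset (fun I => indep M I && (I \subset X)) I & set0 \subset I}.
  by apply: maxset_exists; rewrite indep0 sub0set.
apply: leq_trans (leq_bigmax_cond I _); last by rewrite Ii.
rewrite -dimI ?(subset_trans IX) //; apply/dimvS/span_subvP => v.
rewrite mem_enum => /imsetP[t tX ->]; apply: contraT => tI.
have tnI : t \notin I.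
  by apply: contra tI => tI; rewrite memv_span // mem_enum imset_f.
suff : t |: I = I by move=> tIE; rewrite -tIE setU11 in tnI.
apply: Imax; last exact: subsetUr.
have tIX : t |: I \subset X by rewrite subUset sub1set tX.
rewrite tIX andbT hindep ?(subset_trans tIX) //.
have Ih : PG_indep (h @: I) by rewrite -hindep ?(subset_trans IX).
have -> : h @: (t |: I) = [set x in h t :: enum (h @: I)].
  by apply/setP => x; rewrite imsetU1 !inE mem_enum.
rewrite PG_indep_set ?free_cons ?tI //= enum_uniq andbT mem_enum.
by apply: contra tI => tI; rewrite memv_span // mem_enum.
Qed.

(** * Triangles, fanos and hyperplanes in coordinates *)

Lemma triangle_coordinates : isomorphic M triangle ->
  exists x y z, [/\ x \in ground M, y \in ground M, z \in ground M & h z = h x + h y].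
Proof.
case/(isomorphic_fun 0) => g [ginj gim gindep].
have gM : binary_coordinates M g by [].
pose e1 : 'rV['F_2]_2 := delta_mx 0 0; pose e2 : 'rV['F_2]_2 := delta_mx 0 1.
have e20 : e2 != 0 by apply/rV0Pn; exists 1; rewrite mxE.
have free12 : free [:: e1; e2].
  rewrite free_cons seq1_free e20 andbT span_seq1; apply/vlineP => -[k].
  by move/rowP/(_ 0); rewrite !mxE /= mulr0; apply/eqP.
have e120 : e1 + e2 != 0 by apply/rV0Pn; exists 1; rewrite !mxE.
have e10 : e1 != 0 by apply/rV0Pn; exists 0; rewrite mxE.
have pick e : e != 0 -> exists2 x, x \in ground M & g x = e.
  move=> e0; have : e \in g @: ground M by rewrite gim inE.
  by case/imsetP=> x xM ->; exists x.
have [x xM gx] := pick _ e10; have [y yM gy] := pick _ e20.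
have [z zM gz] := pick _ e120.
exists x, y, z; split=> //.
have xy : x != y.
  by apply: contraTneq (free_uniq free12) => xy; rewrite -gx xy gy /= inE eqxx.
have zx : z != x.
  apply: contraNneq e20 => zx; move: gz; rewrite zx gx -[LHS]addr0 => /addrI <-.
  by rewrite eqxx.
have zy : z != y.
  apply: contraNneq e10 => zy; move: gz; rewrite zy gy -[LHS]add0r => /addIr <-.
  by rewrite eqxx.
(* Both [g] and [h] reflect independence in [M], so freeness passes from one to the other. *)
have hgfree s : uniq s -> {subset s <= ground M} -> free (map h s) = free (map g s).
  by move=> us sM; rewrite -(coordinates_free hM) // -(coordinates_free gM).
have hxy : free [:: h x; h y].
  rewrite (hgfree [:: x; y]) /= ?gx ?gy ?inE ?xy //.
  by move=> t; rewrite !inE => /pred2P[]->.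
have hz : h z != 0.
  rewrite -seq1_free (hgfree [:: z]) //= ?seq1_free ?gz //.
  by move=> t; rewrite inE => /eqP->.
have : ~~ free [:: h z; h x; h y].
  rewrite (hgfree [:: z; x; y]) /= ?inE ?negb_or ?zx ?zy ?xy //; last first.
    by move=> t; rewrite !inE => /or3P[]/eqP->.
  rewrite gx gy gz free_cons free12 andbT negbK.
  by rewrite memvD // memv_span ?inE ?eqxx ?orbT.
rewrite free_cons hxy andbT negbK span_cons span_seq1.
case/memv_addP => _ /vlineP[k ->] [_ /vlineP[l ->]] hzE.
have inj := proj1 hM.
(* Since [h z] is nonzero and differs from [h x] and [h y], both coefficients must be 1. *)
case: (F2_cases k) (F2_cases l) hzE => -> [] -> /=;
  rewrite ?scale0r ?scale1r ?add0r ?addr0 //.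
- by move=> h0; rewrite h0 eqxx in hz.
- by move/(inj _ _ zM yM) => zyE; rewrite zyE eqxx in zy.
- by move/(inj _ _ zM xM) => zxE; rewrite zxE eqxx in zx.
Qed.

(** The listed vectors are the seven nonzero combinations of [a], [x], [y]. None is 0, so these
    three are independent, and the points mapped into their span form the fano. *)
Lemma fano_coordinates (a x y : 'rV['F_2]_n) : 0 \notin h @: ground M ->
  {subset [:: a; x; y; a + x; a + y; x + y; a + x + y] <= h @: ground M} ->
  exists2 X : {set T}, X \subset ground M & isomorphic (restriction M X) fano.
Proof.
move=> h0 sub; have [hinj hindep] := hM.
pose B : 'M['F_2]_(3, n) := \matrix_(i < 3) [:: a; x; y]`_i.
have BE (c : 'rV_3) : c *m B = c 0 0 *: a + c 0 1 *: x + c 0 2 *: y.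
  rewrite mulmx_sum_row !big_ord_recl big_ord0 addr0 addrA !rowK /=.
  by congr (c 0 _ *: _ + c 0 _ *: _ + c 0 _ *: _); apply: val_inj.
have Bh (c : 'rV_3) : c != 0 -> c *m B \in h @: ground M.
  move=> c0; have : [|| c 0 0 != 0, c 0 1 != 0 | c 0 2 != 0].
    apply: contraNT c0; rewrite !negb_or !negbK => /and3P[/eqP c0 /eqP c1 /eqP c2].
    apply/eqP/rowP => -[[|[|[|//]]] i]; rewrite mxE;
      [rewrite -[RHS]c0|rewrite -[RHS]c1|rewrite -[RHS]c2];
      by congr (c 0 _); apply: val_inj.
  rewrite BE; case: (F2_cases (c 0 0)) => ->; case: (F2_cases (c 0 1)) => ->;
    case: (F2_cases (c 0 2)) => ->; rewrite ?eqxx // => _;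
    rewrite ?scale0r ?scale1r ?add0r ?addr0; apply: sub; rewrite !inE eqxx ?orbT //.
have Bfree : row_free B.
  apply: inj_row_free => c cB; apply: contraNeq h0 => /Bh; by rewrite cB.
have Binj : injective (mulmxr B : 'rV_3 -> 'rV_n) by exact: row_free_inj Bfree.
pose X := [set t in ground M | (h t <= B)%MS].
exists X; first by apply/subsetP => t; rewrite inE => /andP[].
(* On [X] the pseudo-inverse recovers coordinates with respect to the basis [a], [x], [y]. *)
pose g t : 'rV_3 := h t *m pinvmx B.
have gE t : t \in X -> h t = g t *m B by rewrite inE => /andP[_ /mulmxKpV].
have MX : ground M :&: X = X.
  by apply/setIidPr/subsetP => t; rewrite inE => /andP[].
have XM : X \subset ground M by rewrite -MX subsetIl.
apply: (@fun_isomorphic _ _ _ _ g); rewrite /= ?MX.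
- move=> s t sX tX st; apply: hinj; rewrite ?(subsetP XM) //.
  by rewrite (gE s) // (gE t) // st.
- apply/setP => c; rewrite inE; apply/imsetP/idP => [[t tX ->]|c0].
    apply: contraNneq h0 => gt; apply/imsetP; exists t; rewrite ?(subsetP XM) //.
    by rewrite gE // gt mul0mx.
  have /imsetP[t tM ht] := Bh _ c0.
  have tX : t \in X by rewrite inE tM -ht submxMl.
  by exists t => //; apply: Binj; rewrite /= -gE.
- move=> I IX; rewrite /restr_indep IX andbT hindep ?(subset_trans IX) //.
  rewrite -(PG_indep_linear (g @: I) Binj) -imset_comp; congr PG_indep.
  by apply: eq_in_imset => t /(subsetP IX) /gE.
Qed.

(** The image of the set spans the kernel of [dot u], of codimension 1; adding a point outside the
    kernel raises the dimension, which gives flatness. *)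
Lemma hyperplane_coordinates u : u != 0 -> h @: ground M = [set v | v != 0] ->
  hyperplane M [set t in ground M | dot u (h t) == 0].
Proof.
move=> u0 him; set H := [set _ in _ | _].
have HM : H \subset ground M by apply/subsetP => t; rewrite inE => /andP[].
pose f := linfun (mulmxr u^T : 'rV['F_2]_n -> 'rV_1); pose K := lker f.
have KE v : (v \in K) = (dot u v == 0).
  rewrite memv_ker lfunE /= /dot; apply/eqP/eqP => [->|v0]; first by rewrite mxE.
  by apply/rowP => i; rewrite !ord1 v0 mxE.
have spanH : <<enum (h @: H)%SET>>%VS = K.
  apply/eqP; rewrite eqEsubv; apply/andP; split.
    apply/span_subvP => v; rewrite mem_enum => /imsetP[t + ->].
    by rewrite inE KE => /andP[].
  apply/subvP => v; rewrite KE => uv; have [->|v0] := eqVneq v 0; first exact: mem0v.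
  have : v \in h @: ground M by rewrite him inE.
  case/imsetP => t tM vt; apply: memv_span; rewrite mem_enum vt imset_f //.
  by rewrite inE tM -vt.
have spanM : <<enum (h @: ground M)%SET>>%VS = fullv.
  apply/eqP; rewrite eqEsubv subvf; apply/subvP => v _.
  have [->|v0] := eqVneq v 0; first exact: mem0v.
  by apply: memv_span; rewrite mem_enum him inE.
have dimK : (\dim K).+1 = \dim {: 'rV['F_2]_n}.
  rewrite -(limg_ker_dim f fullv) capfv -addn1.
  congr addn; apply/eqP; rewrite eq_sym eqn_leq; apply/andP; split.
    by apply: leq_trans (dimvS (subvf _)) _; rewrite dimvf /dim /= muln1.
  have [x ux] := dot_nondeg u0.
  rewrite lt0n dimv_eq0; apply/eqP => lim0.
  have : f x \in (f @: fullv)%VS by rewrite memv_img ?memvf.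
  rewrite lim0 memv0 lfunE /= => /eqP/rowP/(_ 0).
  by move: ux; rewrite dotC /dot => ->; rewrite mxE; apply/eqP; rewrite oner_eq0.
rewrite /hyperplane /flat HM !rank_coordinates // spanH spanM dimK eqxx andbT /=.
apply/forall_inP => t; rewrite !inE => /andP[+ tM]; rewrite tM /= => ut.
have tHM : t |: H \subset ground M by rewrite subUset sub1set tM.
rewrite rank_coordinates // -dimK ltn_neqAle.
have sub : (K <= <<enum (h @: (t |: H))%SET>>)%VS.
  by rewrite -spanH; apply: sub_span => v; rewrite !mem_enum imsetU1 inE orbC => ->.
rewrite (dimvS sub) andbT; apply: contraNneq ut => dimE.
have KE' : K = <<enum (h @: (t |: H))%SET>>%VS.
  by apply/eqP; rewrite eqEdim sub dimE /=.
by rewrite -KE KE' memv_span // mem_enum imset_f // setU11.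
Qed.

End Coordinates.

(** * From vectors back to representations *)

Theorem theorem3p2 (r : nat) (T : finType) (E : {set T}) (G : matroid T)
  (hr : (3 <= r)%N)
  (hEG : binary_representation r E G)
  (hfano : fano_free E G)
  (hE : 5 / 8 * 2 ^+ r < (#|E|%:R : rat)) :
  exists H : {set T},
    [/\ hyperplane G H,
        triangle_free (E :&: H) (restriction G H)
      & 1 / 4 * 2 ^+ (r - 1) < (#|E :&: H|%:R : rat)].
Proof.
case: hEG => /(isomorphic_fun 0)[h [hinj him hindep]] EG.
have hG : binary_coordinates G h by [].
have cardE (X : {set T}) : X \subset ground G -> #|h @: X| = #|X|.
  move=> /subsetP XG; apply: card_in_imset => x y /XG xG /XG yG; exact: hinj.
have big : (5 * 2 ^ r < 8 * #|h @: E|)%N.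
  rewrite cardE // -(ltr_nat rat) !natrM natrX; lra.
have E0 : 0 \notin h @: E.
  apply/negP => /(subsetP (imsetS h EG)); rewrite him inE eqxx //.
have groundE : ground (restriction G E) = E by apply/setIidPr.
have [|u u0 tri] := dense_fano_free E0 _ big.
  move=> a x y aE xE yE axE ayE xyE; apply/negP => axyE; apply: hfano.
  apply: (fano_coordinates (restriction_coordinates E hG) (a := a) (x := x) (y := y)).
    by rewrite groundE.
  by move=> v; rewrite groundE !inE; do 6!(case/predU1P; first by move=> ->); move/eqP->.
set H := [set t in ground G | dot u (h t) == 0].
exists H; split; first exact: hyperplane_coordinates.
  case=> X _ iso.
  have hX : binary_coordinates
      (restriction (restriction (restriction G H) (E :&: H)) X) h.
    by do 3!apply: restriction_coordinates.
  have [x [y [z [xX yX zX hz]]]] := triangle_coordinates hX iso.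
  have inE' t : t \in ground (restriction (restriction (restriction G H) (E :&: H)) X) ->
      h t \in h @: E /\ dot u (h t) = 0.
    rewrite /= => /setIP[/setIP[_ /setIP[tE]] +] _; rewrite inE => /andP[_ /eqP ut].
    by split=> //; apply: imset_f.
  have [xE ux] := inE' _ xX; have [yE uy] := inE' _ yX; have [zE _] := inE' _ zX.
  by apply: (tri (h x) (h y)); rewrite -?hz.
(* Outside [H] there are only [2 ^ r / 2] points, which leaves more than [5 / 8 - 1 / 2 = 1 / 8] of
   [2 ^ r] for [E :&: H]. *)
have EH : h @: (E :\: H) \subset [set v | dot u v == 1].
  apply/subsetP => v /imsetP[t + ->]; rewrite !inE => /andP[+ tE].
  by rewrite (subsetP EG) //=; case: (F2_cases (dot u (h t))) => ->.
have EHbig : (2 ^ r < 8 * #|E :&: H|)%N.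
  move: (subset_leq_card EH) (card_dot 1 u0) (cardsID H E) big.
  rewrite !cardE ?(subset_trans (subsetDl _ _)) //.
  move: #|E :&: H| #|E :\: H| #|E| #|[set v | dot u v == 1]| (2 ^ r)%N; lia.
have : 2 ^+ r = 2 * 2 ^+ (r - 1) :> rat by rewrite -exprS subn1 prednK // ltnW // ltnW.
move: EHbig; rewrite -(ltr_nat rat) natrM natrX; lra.
Qed.
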